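(* Let $d\ge 1$ and let $\mathbf{u},\mathbf{v}\in\mathbb{R}^d$ with $\mathbf{u}\cdot\mathbf{v}\ne 0$. Then: (1) $|\mathrm{recos}(\mathbf{u},\mathbf{v})|\le 1$, and equality holds if and only if either $\mathbf{u}\cdot\mathbf{v}>0$ and $\mathbf{u},\mathbf{v}$ are similar vectors, or $\mathbf{u}\cdot\mathbf{v}<0$ and $\mathbf{u},\mathbf{v}$ are discordant vectors. (2) $|\cos(\mathbf{u},\mathbf{v})|\le 1$, and equality holds if and only if $\mathbf{u}$ and $\mathbf{v}$ are linearly dependent, i.e., there exists a scalar $k\in\mathbb{R}$ such that $\mathbf{v}=k\mathbf{u}$. (3) $|\mathrm{decos}(\mathbf{u},\mathbf{v})|\le 1$, and equality holds if and only if $\mathbf{u}=\mathbf{v}$ or $\mathbf{u}=-\mathbf{v}$.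
   Context: For $\mathbf{u}=(u_1,\dots,u_d)$, $\mathbf{v}=(v_1,\dots,v_d)$ in $\mathbb{R}^d$, $\mathbf{u}\cdot\mathbf{v}=\sum_{i=1}^d u_iv_i$ and $\|\mathbf{u}\|=\sqrt{\sum_{i=1}^d u_i^2}$. $\mathbf{u}$ and $\mathbf{v}$ are similar vectors if $(u_i-u_j)(v_i-v_j)\ge 0$ for all $1\le i,j\le d$. They are discordant vectors if $(u_i-u_j)(v_i-v_j)\le 0$ for all $1\le i,j\le d$. For a vector $\mathbf{w}\in\mathbb{R}^d$, $\mathbf{w}^{\uparrow}$ denotes the vector obtained by sorting the components of $\mathbf{w}$ in non-decreasing order, and $\mathbf{w}^{\downarrow}$ the vector obtained by sorting them in non-increasing order. Given $\mathbf{u},\mathbf{v}$ with $\mathbf{u}\cdot\mathbf{v}\ne 0$, the vector $\mathbf{v}^{\updownarrow}$ (which depends on $\mathbf{u}$ as well) is defined as $\mathbf{v}^{\updownarrow}=\mathbf{v}^{\uparrow}$ if $\mathbf{u}\cdot\mathbf{v}>0$ and $\mathbf{v}^{\updownarrow}=\mathbf{v}^{\downarrow}$ if $\mathbf{u}\cdot\mathbf{v}<0$. For $\mathbf{u}\cdot\mathbf{v}\neq 0$ define $$\mathrm{recos}(\mathbf{u},\mathbf{v})=\frac{\mathbf{u}\cdot\mathbf{v}}{|\mathbf{u}^{\uparrow}\cdot\mathbf{v}^{\updownarrow}|},\qquad \cos(\mathbf{u},\mathbf{v})=\frac{\mathbf{u}\cdot\mathbf{v}}{\|\mathbf{u}\|\|\mathbf{v}\|},\qquad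 \mathrm{decos}(\mathbf{u},\mathbf{v})=\frac{\mathbf{u}\cdot\mathbf{v}}{\frac12(\|\mathbf{u}\|^2+\|\mathbf{v}\|^2)}.$$ *)

(* Defs.v *)
From mathcomp Require Export all_boot all_order all_algebra.
From mathcomp Require Export reals.
Set Implicit Arguments.
Unset Strict Implicit.
Unset Printing Implicit Defensive.
Import Order.TTheory GRing.Theory Num.Theory.
Local Open Scope ring_scope.

Definition dotv (R : realType) (d : nat) (u v : 'rV[R]_d) : R :=
  \sum_(i < d) u 0 i * v 0 i.

(* The Euclidean norm. It is defined here because the norm `|u| that
   MathComp-Analysis puts on 'rV[R]_d is the sup norm. *)
Definition enorm (R : realType) (d : nat) (u : 'rV[R]_d) : R :=
  Num.sqrt (\sum_(i < d) u 0 i ^+ 2).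

Definition similar_vectors (R : realType) (d : nat) (u v : 'rV[R]_d) : Prop :=
  forall i j : 'I_d, 0 <= (u 0 i - u 0 j) * (v 0 i - v 0 j).

Definition discordant_vectors (R : realType) (d : nat) (u v : 'rV[R]_d) : Prop :=
  forall i j : 'I_d, (u 0 i - u 0 j) * (v 0 i - v 0 j) <= 0.

Definition sort_up (R : realType) (d : nat) (w : 'rV[R]_d) : 'rV[R]_d :=
  \row_(i < d) tnth (sort_tuple <=%R [tuple w 0 j | j < d]) i.

(* >=%R x y means y <= x, so this sorts in non-increasing order. *)
Definition sort_down (R : realType) (d : nat) (w : 'rV[R]_d) : 'rV[R]_d :=
  \row_(i < d) tnth (sort_tuple >=%R [tuple w 0 j | j < d]) i.

(* The rearrangement of v whose direction depends on the sign of u . v.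
   It is meaningful only when dotv u v != 0; the value when dotv u v = 0
   is junk. *)
Definition sort_updown (R : realType) (d : nat) (u v : 'rV[R]_d) : 'rV[R]_d :=
  if 0 < dotv u v then sort_up v else sort_down v.

Definition recos (R : realType) (d : nat) (u v : 'rV[R]_d) : R :=
  dotv u v / `|dotv (sort_up u) (sort_updown u v)|.

Definition cosv (R : realType) (d : nat) (u v : 'rV[R]_d) : R :=
  dotv u v / (enorm u * enorm v).

Definition decos (R : realType) (d : nat) (u v : 'rV[R]_d) : R :=
  dotv u v / (2^-1 * (enorm u ^+ 2 + enorm v ^+ 2)).

(* Main.v *)
Require Import Defs.
From mathcomp Require Import all_boot all_order all_algebra.
From mathcomp Require Import reals.
From mathcomp Require Import fingroup perm ring lra.
Import Order.TTheory GRing.Theory Num.Theory.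
Local Open Scope ring_scope.
Set Implicit Arguments.
Unset Strict Implicit.

(** For (1): if u and v are similar, sorting the pairs (u_i, v_i)
    componentwise sorts both vectors at once, so u . v is the product of the
    sorted vectors; if they are not, exchanging two entries of v strictly
    increases u . v.  Hence a rearrangement of v maximizing the product with u
    is similar to u, and the maximum is the product of the sorted vectors.
    The negative case follows by replacing v with - v.  For (2) and (3),
    expand the square norms of v - ((u . v) / (u . u)) u and of u -+ v. *)

(** * Cauchy-Schwarz, the mean-square bound, and their equality cases *)

Section InnerProduct.
Variables (R : realType) (d : nat).
Implicit Types (u v w : 'rV[R]_d) (k : R).

Lemma dotvC u v : dotv u v = dotv v u.
Proof. by apply: eq_bigr => i _; rewrite mulrC. Qed.

Lemma dotvDr u v w : dotv u (v + w) = dotv u v + dotv u w.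
Proof. by rewrite -big_split; apply: eq_bigr => i _; rewrite mxE mulrDr. Qed.

Lemma dotvZr k u v : dotv u (k *: v) = k * dotv u v.
Proof. by rewrite mulr_sumr; apply: eq_bigr => i _; rewrite mxE mulrCA. Qed.

Lemma dotvNr u v : dotv u (- v) = - dotv u v.
Proof. by rewrite -scaleN1r dotvZr mulN1r. Qed.

Lemma dotvv_ge0 u : 0 <= dotv u u.
Proof. by apply: sumr_ge0 => i _; rewrite -expr2 sqr_ge0. Qed.

Lemma dotvv_eq0 u : dotv u u = 0 -> u = 0.
Proof.
move=> /eqP; rewrite psumr_eq0 => [/allP u0|i _]; last by rewrite -expr2 sqr_ge0.
apply/rowP => i; have := u0 i (mem_index_enum i).
by rewrite /= -expr2 sqrf_eq0 mxE => /eqP.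
Qed.

Lemma dotv_linear_comb k u v :
  dotv (v + k *: u) (v + k *: u)
  = dotv v v + 2 * k * dotv u v + k ^+ 2 * dotv u u.
Proof.
rewrite dotvDr dotvZr !(dotvC (v + _)) !dotvDr !dotvZr (dotvC v u).
by ring.
Qed.

Lemma enormE u : enorm u = Num.sqrt (dotv u u).
Proof. by rewrite /enorm; congr Num.sqrt; apply: eq_bigr => i _; rewrite expr2. Qed.

Lemma sqr_enorm u : enorm u ^+ 2 = dotv u u.
Proof. by rewrite enormE sqr_sqrtr ?dotvv_ge0. Qed.

Lemma cauchy_schwarz u v : `|dotv u v| <= enorm u * enorm v.
Proof.
have [u0|uN0] := eqVneq (dotv u u) 0.
  rewrite (dotvv_eq0 u0) dotvC /dotv big1 ?normr0 => [|i _].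
    by rewrite mulr_ge0 ?sqrtr_ge0.
  by rewrite mxE mulr0.
have uu_gt0 : 0 < dotv u u by rewrite lt_def uN0 dotvv_ge0.
rewrite !enormE -sqrtrM ?dotvv_ge0 // -sqrtr_sqr ler_wsqrtr //.
(* This vector is [v] minus its orthogonal projection on [u]; [dotv u u] times its square norm is
   the Gram determinant of [u] and [v]. *)
have := dotvv_ge0 (v + (- (dotv u v / dotv u u)) *: u).
rewrite dotv_linear_comb => /(mulr_ge0 (ltW uu_gt0)).
set x := (X in 0 <= X); suff -> : x = dotv u u * dotv v v - dotv u v ^+ 2.
  by rewrite subr_ge0.
by rewrite /x; field.
Qed.

(** The hypothesis excludes [u = 0], where equality holds for every [v] but only [v = 0] is a
    multiple of [u]. *)
Lemma cauchy_schwarz_eq u v : dotv u u != 0 ->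
  `|dotv u v| = enorm u * enorm v <-> exists k, v = k *: u.
Proof.
move=> uN0; split=> [uvE|[k ->]]; last first.
  rewrite dotvZr !enormE dotvZr (dotvC (k *: u)) dotvZr mulrA -expr2.
  rewrite sqrtrM ?sqr_ge0 // sqrtr_sqr mulrCA -expr2 sqr_sqrtr ?dotvv_ge0 //.
  by rewrite normrM (ger0_norm (dotvv_ge0 u)).
(* The witness is the coefficient of the projection of [v] on [u]. Equality makes the Gram
   determinant vanish, so the remainder has norm zero. *)
exists (dotv u v / dotv u u); apply/eqP; rewrite -subr_eq0; apply/eqP.
apply: dotvv_eq0; rewrite -scaleNr dotv_linear_comb.
have : dotv u v ^+ 2 = dotv u u * dotv v v.
  by rewrite -!sqr_enorm -exprMn -uvE real_normK ?num_real.
move=> e; apply: (mulfI uN0); rewrite mulr0.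
have -> : 0 = dotv u u * dotv v v - dotv u v ^+ 2 by rewrite e subrr.
by field.
Qed.

Lemma dotv_mean_square u v :
  `|dotv u v| <= 2^-1 * (enorm u ^+ 2 + enorm v ^+ 2).
Proof.
have := dotvv_ge0 (u + 1 *: v); have := dotvv_ge0 (u + (-1) *: v).
rewrite !dotv_linear_comb !sqr_enorm (dotvC v u) => ge1 ge2.
by rewrite ler_norml; apply/andP; split; lra.
Qed.

Lemma dotv_mean_square_eq u v :
  `|dotv u v| = 2^-1 * (enorm u ^+ 2 + enorm v ^+ 2) <-> u = v \/ u = - v.
Proof.
rewrite !sqr_enorm; split=> [|[]->]; last first.
- rewrite (dotvC (- v) v) !dotvNr (dotvC (- v) v) dotvNr opprK normrN.
  by rewrite ger0_norm ?dotvv_ge0 //; lra.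
- by rewrite ger0_norm ?dotvv_ge0 //; lra.
(* According to the sign of [dotv u v], equality forces the square norm of [u - v] or of [u + v] to
   vanish. *)
case: (ger0P (dotv u v)) => _ e; [left|right]; apply/eqP.
  rewrite -subr_eq0 -scaleN1r; apply/eqP/dotvv_eq0.
  by rewrite dotv_linear_comb (dotvC v u); lra.
rewrite -addr_eq0 -[v]scale1r; apply/eqP/dotvv_eq0.
by rewrite dotv_linear_comb (dotvC v u); lra.
Qed.

End InnerProduct.

(** * The rearrangement inequality and its equality case *)

Section Rearrangement.
Variables (R : realType) (d : nat).
Implicit Types (u v w : 'rV[R]_d) (s : 'S_d).

Lemma sort_upE w i : sort_up w 0 i = (sort <=%R [seq w 0 j | j <- enum 'I_d])`_i.
Proof. by rewrite mxE (tnth_nth 0). Qed.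

(** Negation reverses the order; through this, bounds on [sort_down] follow from those on
    [sort_up]. *)
Lemma sort_downE w : sort_down w = - sort_up (- w).
Proof.
apply/rowP => i; rewrite !mxE !(tnth_nth 0) /=.
set l := [seq w 0 j | j <- _].
have -> : [seq (- w) 0 j | j <- enum 'I_d] = map -%R l.
  by rewrite -[RHS]map_comp; apply: eq_map => j; rewrite /= mxE.
rewrite -(map_sort (leT' := >=%R)); last by move=> x y; rewrite /= lerN2.
(* Past the end both sides are the default 0, which negation fixes. *)
have [ilt|ige] := ltnP i (size (sort >=%R l)).
  by rewrite (nth_map 0) ?opprK.
by rewrite !nth_default ?oppr0 // size_map.
Qed.

Lemma sort_up_col_perm s w : sort_up (col_perm s w) = sort_up w.
Proof.
apply/rowP => i; rewrite !sort_upE; congr (nth 0 _ i).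
apply/perm_sortP; [exact: le_total|exact: le_trans|exact: le_anti|].
have -> : [seq (col_perm s w) 0 j | j <- enum 'I_d]
    = [seq w 0 j | j <- [seq s j | j <- enum 'I_d]].
  by rewrite -[RHS]map_comp; apply: eq_map => j; rewrite /= mxE.
apply: perm_map; apply: uniq_perm; rewrite ?enum_uniq //.
  by rewrite map_inj_uniq ?enum_uniq //; exact: perm_inj.
move=> j; rewrite mem_enum -[j in LHS](permKV s) map_f ?mem_enum //.
Qed.

Lemma similar_dotv_sort u v : similar_vectors u v ->
  dotv u v = dotv (sort_up u) (sort_up v).
Proof.
move=> uv; pose l := [seq (u 0 i, v 0 i) | i <- enum 'I_d].
pose r := [rel p q : R * R | (p.1 <= q.1) && (p.2 <= q.2)].
have r_sorted : sorted r (sort r l).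
  (* [r] is only a partial order on [R * R]; similarity makes it total on [l], where a tie in [u] is
     decided by [v]. *)
  apply: (@sort_sorted_in _ (mem l)) => [p q|]; last exact/allP.
  move=> /mapP[i _ ->] /mapP[j _ ->] /=; have := uv i j.
  case: (ltgtP (u 0 i) (u 0 j)) => uij; last by rewrite le_total.
    by rewrite nmulr_rge0 ?subr_lt0 // subr_le0 => ->.
  by rewrite pmulr_rge0 ?subr_gt0 // subr_ge0 => ->.
(* A monotone projection of the sorted pairs is a sorted rearrangement of the entries of [w], and
   such a list is unique. *)
have sort_proj (f : R * R -> R) (w : 'rV[R]_d) :
    (forall p q, r p q -> f p <= f q) -> (forall i, f (u 0 i, v 0 i) = w 0 i) ->
    forall i : 'I_d, sort_up w 0 i = f (nth (0, 0) (sort r l) i).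
  move=> fr fw i; rewrite sort_upE -(nth_map _ 0); last first.
    by rewrite size_sort size_map size_enum_ord.
  congr (nth 0 _ i); apply: (@sorted_eq _ <=%R).
  - exact: le_trans.
  - exact: le_anti.
  - exact/sort_sorted/le_total.
  - by rewrite sorted_map; apply: sub_sorted r_sorted => p q /fr.
  rewrite perm_sort; apply: (@perm_trans _ [seq f p | p <- l]).
    by rewrite -[X in perm_eq _ X]map_comp (eq_map (g := fun j => w 0 j)) //.
  by apply: perm_map; rewrite perm_sym perm_sort.
have -> : dotv u v = \sum_(p <- l) p.1 * p.2 by rewrite big_map big_enum.
rewrite (perm_big (sort r l)) /=; last by rewrite perm_sym perm_sort.
rewrite (big_nth (0, 0)) size_sort size_map size_enum_ord big_mkord.
apply: eq_bigr => i _; congr (_ * _); apply/esym.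
  by apply: sort_proj => // p q /andP[].
by apply: sort_proj => // p q /andP[].
Qed.

Lemma dotv_col_tperm u v (i j : 'I_d) :
  dotv u (col_perm (tperm i j) v)
  = dotv u v - (u 0 i - u 0 j) * (v 0 i - v 0 j).
Proof.
(* Isolating the two terms that the exchange affects requires distinct indices. *)
have [->|ij] := eqVneq i j.
  rewrite !subrr mul0r subr0; apply: eq_bigr => k _.
  by rewrite mxE tperm1 perm1.
have split_ij (F : 'I_d -> R) :
    \sum_k F k = F i + (F j + \sum_(k | (k != i) && (k != j)) F k).
  by rewrite (bigD1 i) // (bigD1 j) // eq_sym.
rewrite /dotv !split_ij !mxE tpermL tpermR.
rewrite [X in _ + (_ + X)](eq_bigr (fun k => u 0 k * v 0 k)); first by ring.
by move=> k /andP[ki kj]; rewrite mxE tpermD // eq_sym.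
Qed.

(** Transpositions suffice: the gain from exchanging entries [i] and [j] is minus the product in the
    definition of similarity. *)
Lemma dotv_max_similar u v :
  (forall s, dotv u (col_perm s v) <= dotv u v) -> similar_vectors u v.
Proof.
by move=> max_v i j; have := max_v (tperm i j); rewrite dotv_col_tperm; lra.
Qed.

Lemma dotv_col_perm_le_sort u v s :
  dotv u (col_perm s v) <= dotv (sort_up u) (sort_up v).
Proof.
(* A maximizing [t] exists because ['S_d] is finite. Rearranging [col_perm t v] again gives a
   rearrangement of [v], so it is maximal too, hence similar to [u]; sorting it then forgets [t]. *)
case: (@arg_maxP _ _ _ (1%g : 'S_d) predT (fun t => dotv u (col_perm t v)))
  => // t _ t_max.
have t_sim : similar_vectors u (col_perm t v).
  by apply: dotv_max_similar => s'; rewrite -col_permM; exact: t_max.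
by rewrite -(sort_up_col_perm t v) -(similar_dotv_sort t_sim); exact: t_max.
Qed.

Lemma dotv_le_sort u v : dotv u v <= dotv (sort_up u) (sort_up v).
Proof. by have := dotv_col_perm_le_sort u v 1%g; rewrite col_perm1. Qed.

Lemma dotv_eq_sort u v :
  dotv u v = dotv (sort_up u) (sort_up v) <-> similar_vectors u v.
Proof.
split=> [uvE|]; last exact: similar_dotv_sort.
(* Attaining the common bound of all rearrangements makes [v] a maximizer. *)
by apply: dotv_max_similar => s; rewrite uvE dotv_col_perm_le_sort.
Qed.

Lemma similar_oppr u v : similar_vectors u (- v) <-> discordant_vectors u v.
Proof.
have e i j : (u 0 i - u 0 j) * ((- v) 0 i - (- v) 0 j)
    = - ((u 0 i - u 0 j) * (v 0 i - v 0 j)) by rewrite !mxE; ring.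
by split=> H i j; move: (H i j); rewrite e oppr_ge0.
Qed.

Lemma dotv_sort_down u v :
  dotv (sort_up u) (sort_down v) = - dotv (sort_up u) (sort_up (- v)).
Proof. by rewrite sort_downE dotvNr. Qed.

Lemma sort_down_le_dotv u v : dotv (sort_up u) (sort_down v) <= dotv u v.
Proof. by rewrite dotv_sort_down lerNl -dotvNr dotv_le_sort. Qed.

Lemma dotv_eq_sort_down u v :
  dotv u v = dotv (sort_up u) (sort_down v) <-> discordant_vectors u v.
Proof.
rewrite -similar_oppr -dotv_eq_sort dotv_sort_down dotvNr.
by split=> [->|<-]; rewrite opprK.
Qed.

End Rearrangement.

(** Reduces each of the three claims to a bound on [dotv u v] and its equality case; a nonzero [x]
    forces [y] to be positive. *)
Lemma norm_ratio_le1 (R : realFieldType) (x y : R) : x != 0 -> `|x| <= y ->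
  `|x / y| <= 1 /\ (`|x / y| = 1 <-> `|x| = y).
Proof.
move=> xN0 xy; have y_gt0 : 0 < y by apply: lt_le_trans xy; rewrite normr_gt0.
rewrite normrM normfV (gtr0_norm y_gt0) ler_pdivrMr // mul1r; split=> //.
split=> [e|->]; last by rewrite divff ?gt_eqF.
by rewrite -[LHS](divfK (x := y)) ?gt_eqF // e mul1r.
Qed.

Theorem corollary1 (R : realType) (d : nat) (hd : (1 <= d)%N)
    (u v : 'rV[R]_d) (huv : dotv u v <> 0) :
  (`|recos u v| <= 1 /\
     (`|recos u v| = 1 <->
        (0 < dotv u v /\ similar_vectors u v) \/
        (dotv u v < 0 /\ discordant_vectors u v))) /\
  (`|cosv u v| <= 1 /\
     (`|cosv u v| = 1 <-> exists k : R, v = k *: u)) /\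
  (`|decos u v| <= 1 /\
     (`|decos u v| = 1 <-> u = v \/ u = - v)).
Proof.
have uvN0 : dotv u v != 0 by apply/eqP.
split; last split.
- rewrite /recos /sort_updown; case: (ltrgt0P (dotv u v)) huv => // uv_sgn _.
  + have le_uv := dotv_le_sort u v.
    (* The sorted product is at least [dotv u v], hence positive, which removes the absolute value
       in the denominator. *)
    rewrite (gtr0_norm (lt_le_trans uv_sgn le_uv)).
    have [|-> ->] := norm_ratio_le1 uvN0 (y := dotv (sort_up u) (sort_up v)).
      by rewrite gtr0_norm.
    rewrite gtr0_norm // dotv_eq_sort; split=> //.
    by split=> [?|[[]|[]]//]; left.
  + have le_uv := sort_down_le_dotv u v.
    (* Here the oppositely sorted product is at most [dotv u v], hence negative. *)
    rewrite (ltr0_norm (le_lt_trans le_uv uv_sgn)).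
    have [|-> ->] := norm_ratio_le1 uvN0 (y := - dotv (sort_up u) (sort_down v)).
      by rewrite ltr0_norm // lerN2.
    rewrite ltr0_norm // -dotv_eq_sort_down; split=> //.
    by split=> [/oppr_inj ?|[[]|[_ ->]]//]; right.
- have [-> ->] := norm_ratio_le1 uvN0 (cauchy_schwarz u v); split=> //.
  (* A vanishing [dotv u u] would give [u = 0] and so [dotv u v = 0]. *)
  apply: cauchy_schwarz_eq; apply: contra_not_neq huv => /dotvv_eq0 ->.
  by rewrite dotvC -(scale0r 0) dotvZr mul0r.
- have [-> ->] := norm_ratio_le1 uvN0 (dotv_mean_square u v); split=> //.
  exact: dotv_mean_square_eq.
Qed.
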